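(* For all integers $d,n,k\ge1$, the group $\mathrm{OB}(\mathbb{Z}^d,n,k)$ of oblivious Turing machines is finitely generated.
   Context: Let $\Sigma=\{0,\dots,n-1\}$, $Q=\{1,\dots,k\}$. Let $X_k=\{y\in\{0,1,\dots,k\}^{\mathbb{Z}^d} : y_{\vec u}\ne0\text{ and }y_{\vec v}\neq 0\implies \vec u=\vec v\}$ and $X_{n,k}=\Sigma^{\mathbb{Z}^d}\times X_k$. Given finite $F,F'\subset\mathbb{Z}^d$ and $f:\Sigma^F\times Q\to\Sigma^{F'}\times Q\times\mathbb{Z}^d$ (a local rule), the map $T_f:X_{n,k}\to X_{n,k}$ is defined by: $T_f(x,y)=(x,y)$ if $y$ is identically $0$; otherwise let $\vec v$ be the unique position with $q=y_{\vec v}\ne 0$, let $p\in\Sigma^F$ with $p_{\vec u}=x_{\vec v+\vec u}$, and $f(p,q)=(p',q',\vec e)$; then $T_f(x,y)=(\tilde x,\tilde y)$ with $\tilde x_{\vec t}=p'_{\vec t-\vec v}$ if $\vec t-\vec v\in F'$, $\tilde x_{\vec t}=x_{\vec t}$ otherwise, and $\tilde y_{\vec v+\vec e}=q'$, $\tilde y_{\vec t}=0$ for $\vec t\ne\vec v+\vec e$. Such maps are the $(d,n,k)$-Turing machines; one is reversible if it has a two-sided inverse that is a $(d,n,k)$-Turing machine. The reversible ones form the group $\mathrm{RTM}(\mathbb{Z}^d,n,k)$ under composition. $\mathrm{SHIFT}(\mathbb{Z}^d,n,k)$ is the group of machines $T_{\vec v}$ ($\vec v\in\mathbb{Z}^d$)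 which never modify the state or the tape and always move the head by $\vec v$. $\mathrm{LP}(\mathbb{Z}^d,n,k)$ (local permutations) is the subgroup of $\mathrm{RTM}(\mathbb{Z}^d,n,k)$ of machines that never move the head (the move component of the local rule is constantly $\vec 0$). $\mathrm{OB}(\mathbb{Z}^d,n,k)=\langle \mathrm{SHIFT}(\mathbb{Z}^d,n,k),\mathrm{LP}(\mathbb{Z}^d,n,k)\rangle\le \mathrm{RTM}(\mathbb{Z}^d,n,k)$. *)

(* Defs.v *)
From HB Require Import structures.
From mathcomp Require Import all_boot all_order all_algebra finmap.
From mathcomp Require Import boolp classical_sets cardinality.

Set Implicit Arguments.
Unset Strict Implicit.
Unset Printing Implicit Defensive.

Import GRing.Theory.

Local Open Scope classical_set_scope.

Section Subgroups.
Variable G : groupType.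
Implicit Types S H : set G.

Definition is_subgroup H : Prop := group_closed [in H].

Definition generated_subgroup S : set G := smallest is_subgroup S.

Definition finitely_generated H : Prop :=
  exists S : set G, finite_set S /\ generated_subgroup S = H.

End Subgroups.

(* The inverse is stored as data, but it is determined by the underlying map,
   so equality of bijections is equality of maps (see bijection_eqP). *)
Record bijection (X : Type) := Bijection {
  bij_fun :> X -> X;
  bij_inv : X -> X;
  bij_funK : cancel bij_fun bij_inv;
  bij_invK : cancel bij_inv bij_fun }.

Section BijectionGroup.
Variable X : Type.
Implicit Types g h : bijection X.

Lemma bijection_eqP g h : bij_fun g = bij_fun h -> g = h.
Proof.
case: g h => [f f' fK f'K] [h h' hK h'K] /= efh.
move: hK h'K; rewrite -efh => hK h'K.
have e' : f' = h' by apply/funext => x; rewrite -{1}[x]h'K fK.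
move: hK h'K; rewrite -e' => hK h'K.
by congr Bijection; exact: Prop_irrelevance.
Qed.

Definition bij_id : bijection X :=
  @Bijection X id id (fun=> erefl) (fun=> erefl).

Definition bij_opp g : bijection X := Bijection (bij_invK g) (bij_funK g).

Definition bij_comp g h : bijection X :=
  Bijection (can_comp (bij_funK g) (bij_funK h))
            (can_comp (bij_invK h) (bij_invK g)).

Lemma bij_compA : associative bij_comp.
Proof. by move=> f g h; apply: bijection_eqP. Qed.

Lemma bij_comp1g : left_id bij_id bij_comp.
Proof. by move=> g; apply: bijection_eqP. Qed.

Lemma bij_compg1 : right_id bij_id bij_comp.
Proof. by move=> g; apply: bijection_eqP. Qed.

Lemma bij_compVg : left_inverse bij_id bij_opp bij_comp.
Proof. by move=> g; apply/bijection_eqP/funext/bij_funK. Qed.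

Lemma bij_compgV : right_inverse bij_id bij_opp bij_comp.
Proof. by move=> g; apply/bijection_eqP/funext/bij_invK. Qed.

HB.instance Definition _ := gen_eqMixin (bijection X).
HB.instance Definition _ := gen_choiceMixin (bijection X).
HB.instance Definition _ := isGroup.Build (bijection X)
  bij_compA bij_comp1g bij_compg1 bij_compVg bij_compgV.

End BijectionGroup.

Section TuringMachines.
Variables d n k : nat.

Local Open Scope ring_scope.

Notation Zd := 'rV[int]_d.
Notation Sigma := 'I_n.

(* The states 1, ..., k, inside {0, ..., k}. *)
Definition state := {q : 'I_k.+1 | q != ord0}.

Definition head_config :=
  {y : Zd -> 'I_k.+1 | forall u v, y u != ord0 -> y v != ord0 -> u = v}.

Definition config : Type := (Zd -> Sigma) * head_config.

Record local_rule := LocalRule {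
  lr_in : {fset Zd};
  lr_out : {fset Zd};
  lr_fun : {ffun lr_in -> Sigma} * state -> {ffun lr_out -> Sigma} * state * Zd }.
Arguments lr_fun : clear implicits.

Lemma head_config_eq (y z : head_config) : sval y =1 sval z -> y = z.
Proof. by case: y z => [y yP] [z zP] /= /funext; exact: eq_exist. Qed.

Fact head_at_subproof (v : Zd) (q : state) (u w : Zd) :
  (if u == v then val q else ord0) != ord0 ->
  (if w == v then val q else ord0) != ord0 -> u = w.
Proof. by case: (u =P v) => [->|]; case: (w =P v) => [->|]; rewrite ?eqxx. Qed.

Definition head_at (v : Zd) (q : state) : head_config :=
  exist _ (fun t => if t == v then val q else ord0) (@head_at_subproof v q).

(* The image of the configuration with tape x and head at v in state q; the
   test by insub is membership of t - v in the window lr_out r. *)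
Definition step (r : local_rule) (x : Zd -> Sigma) (v : Zd) (q : state) :
    config :=
  let: (p', q', e) := lr_fun r ([ffun u : lr_in r => x (v + val u)], q) in
  (fun t => if insub (t - v) is Some u then p' u else x t,
   head_at (v + e) q').

Definition turing_map (r : local_rule) (c : config) : config :=
  match pselect (exists v, sval c.2 v != ord0) with
  | left ex => let v := cid ex in
               step r c.1 (projT1 v) (exist _ (sval c.2 (projT1 v)) (projT2 v))
  | right _ => c
  end.

Lemma turing_map_no_head r x (y : head_config) :
  (forall v, sval y v = ord0) -> turing_map r (x, y) = (x, y).
Proof.
rewrite /turing_map => y0; case: pselect => //= ex.
by exfalso; case: ex => v; rewrite y0 eqxx.
Qed.

Lemma turing_map_head_at r x v q :
  turing_map r (x, head_at v q) = step r x v q.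
Proof.
rewrite /turing_map; case: pselect => /= [ex|]; last first.
  by case; exists v; rewrite eqxx; case: q.
case: (cid ex) => w /= yw; have ewv : w = v.
  by move: yw; case: (w =P v) => //; rewrite eqxx.
by rewrite (_ : exist _ _ _ = q) ?ewv//; apply: val_inj; rewrite /= ewv eqxx.
Qed.

Definition RTM : set (bijection config) :=
  [set g | (exists r, bij_fun g = turing_map r) /\
           (exists r, bij_inv g = turing_map r)].

(* Reads and writes nothing: both windows are empty. *)
Definition shift_rule (v : Zd) : local_rule :=
  @LocalRule fset0 fset0 (fun pq => (pq, v)).

Lemma head_configP (y : head_config) :
  (forall v, sval y v = ord0) \/ exists v q, y = head_at v q.
Proof.
case: (pselect (exists v, sval y v != ord0)) => [[v yv]|y0]; [right|left].
  exists v, (exist (fun q => q != ord0) (sval y v) yv); apply: head_config_eq => t /=.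
  case: eqP => [->//|tv]; apply/eqP/negPn/negP => yt.
  by apply: tv; case: y yv yt => y yP /= yv yt; exact: yP.
by move=> v; apply/eqP/negPn/negP => yv; apply: y0; exists v.
Qed.

Lemma shift_head_at v x w q :
  turing_map (shift_rule v) (x, head_at w q) = (x, head_at (w + v) q).
Proof.
rewrite turing_map_head_at /step /=; congr pair; apply/funext => t.
by case: insubP => //= -[u /= uP]; rewrite in_fset0 in uP.
Qed.

Lemma shift_ruleK v :
  cancel (turing_map (shift_rule v)) (turing_map (shift_rule (- v))).
Proof.
case=> x y; case: (head_configP y) => [y0|[w [q ->]]].
  by rewrite !turing_map_no_head.
by rewrite !shift_head_at addrK.
Qed.

Definition SHIFT : set (bijection config) :=
  [set g | RTM g /\ exists v, bij_fun g = turing_map (shift_rule v)].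

Lemma shift_SHIFT v :
  exists2 g, SHIFT g & bij_fun g = turing_map (shift_rule v).
Proof.
have vK := shift_ruleK (- v); rewrite opprK in vK.
exists (Bijection (shift_ruleK v) vK) => //; split; last by exists v.
by split; [exists (shift_rule v)|exists (shift_rule (- v))].
Qed.

Definition LP : set (bijection config) :=
  [set g | RTM g /\ exists r, bij_fun g = turing_map r /\
                              forall pq, (lr_fun r pq).2 = 0].

(* Generated inside the group of all bijections of the configuration space;
   since SHIFT and LP lie in its subgroup RTM, so does OB. *)
Definition OB : set (bijection config) := generated_subgroup (SHIFT `|` LP).

End TuringMachines.

Arguments lr_fun {d n k} _ _.
Arguments RTM d n k _ : clear implicits.
Arguments SHIFT d n k _ : clear implicits.
Arguments LP d n k _ : clear implicits.
Arguments OB d n k _ : clear implicits.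

(* Main.v *)
Require Import Defs.
From HB Require Import structures.
From mathcomp Require Import all_boot all_order all_algebra finmap.
From mathcomp Require Import boolp classical_sets cardinality.
From mathcomp Require Import fingroup perm zify.

(* Conjugating a local permutation by shifts translates its window, so the unit
   shifts and the permutations of adjacent pairs of cells yield all finitely
   supported permutations of the cells; together with the permutations of one
   four-cell window they yield those of every four-cell window.  Larger windows
   are reached one cell at a time: the commutator of a gate controlled by one
   cell with a gate controlled by another is controlled by both, which produces
   3-cycles and hence all even permutations of the larger window.  Odd
   permutations come for free: when n is odd, an odd permutation remains odd on
   a larger window, and when n is even, every permutation becomes even on a
   window with one more cell. *)

Set Implicit Arguments.
Unset Strict Implicit.
Unset Printing Implicit Defensive.

Import GRing.Theory.

(** * Even permutations of a product *)

Section EvenPermutations.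
Variable T : finType.
Implicit Types (x y z t : T) (s : {perm T}).
Local Open Scope group_scope.

(** Products of permutations are read from left to right, so for distinct points this is the cycle
    sending [x] to [z], [z] to [y] and [y] to [x]. *)
Definition cycle3 x y z : {perm T} := tperm x y * tperm y z.

Lemma cycle3J x y z s : cycle3 x y z ^ s = cycle3 (s x) (s y) (s z).
Proof. by rewrite conjMg !tpermJ. Qed.

Lemma cycle3_rot x y z : x != y -> x != z -> cycle3 x y z = cycle3 y z x.
Proof.
move=> xy xz; rewrite /cycle3 conjgC tpermJ tpermL tpermD 1?eq_sym//.
by rewrite (tpermC x).
Qed.

Lemma cycle3_fix x y z t : t \notin [:: x; y; z] -> cycle3 x y z t = t.
Proof.
by rewrite !inE !negb_or => /and3P[tx ty tz]; rewrite permM !tpermD 1?eq_sym.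
Qed.

Lemma cycle3_move x y z : x != y -> cycle3 x y z x = z.
Proof. by move=> xy; rewrite permM tpermL tpermL. Qed.

Lemma cycle3V x y z : (cycle3 x y z)^-1 = cycle3 z y x.
Proof. by rewrite invMg !tpermV tpermC (tpermC x). Qed.

Lemma odd_cycle3 x y z : x != y -> y != z -> odd_perm (cycle3 x y z) = false.
Proof. by move=> xy yz; rewrite odd_permM !odd_tperm xy yz. Qed.

Lemma fresh_point (l : seq T) : size l < #|T| -> {x | x \notin l}.
Proof.
move=> lT; case: (pickP [predC l]) => [x|l0]; first by exists x.
exfalso; move: lT; rewrite ltnNge => /negP; apply.
rewrite cardE; apply: uniq_leq_size (enum_uniq _) _ => x _.
by have /= /negbFE := l0 x.
Qed.

Lemma cycle3_square x y z : x != y -> x != z -> y != z ->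
  cycle3 x y z = cycle3 z y x * cycle3 z y x.
Proof.
move=> xy xz yz; rewrite cycle3_rot// {2}(@cycle3_rot z) 1?eq_sym//.
by rewrite /cycle3 -mulgA (mulgA (tperm y x)) tperm2 mul1g (tpermC y)
   (tpermC x).
Qed.

(** Two 3-cycles with exactly one common point have a 3-cycle as commutator; together they occupy
    five points. Each is the square of its inverse, and squares matter because a gate that applies a
    square under the control of one cell is even. *)
Lemma cycle3_comm x y z : 4 < #|T| -> x != y -> x != z -> y != z ->
  exists s1 s2 : {perm T}, [~ s1 * s1, s2 * s2] = cycle3 x y z.
Proof.
move=> T5 xy xz yz.
have [a] : {a | a \notin [:: x; y; z]}.
  by apply: fresh_point; exact: leq_trans T5.
have [b] : {b | b \notin [:: x; y; z; a]} by apply: fresh_point.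
rewrite !inE !negb_or => /and4P[bx b_y bz ba] /and3P[ax ay az].
exists (cycle3 x y a), (cycle3 z b x).
rewrite -!cycle3_square// 1?eq_sym//.
have <- : (cycle3 a y x)^-1 * cycle3 a y x ^ cycle3 x b z = cycle3 x y z.
  rewrite cycle3J cycle3V cycle3_move 1?eq_sym// !cycle3_fix.
  + by rewrite /cycle3 -mulgA (mulgA (tperm y a)) (tpermC y a) tperm2 mul1g.
  + by rewrite !inE !negb_or ![y == _]eq_sym xy b_y eq_sym yz.
  + by rewrite !inE !negb_or ax az eq_sym ba.
by [].
Qed.

(** A 3-cycle through a third point outside [l] does this; the bound on [size l] leaves room for
    that point. *)
Lemma even_move (l : seq T) (t t' : T) : (size l).+2 < #|T| ->
  t \notin l -> t' \notin l ->
  exists s : {perm T}, [/\ odd_perm s = false, s t = t' &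
                           forall x, x \in l -> s x = x].
Proof.
move=> lT tl t'l; have [->|tt'] := eqVneq t t'.
  by exists 1; split; rewrite ?odd_perm1 ?perm1// => x _; rewrite perm1.
have [w] : {w | w \notin [:: t, t' & l]} by apply: fresh_point.
rewrite !inE !negb_or => /and3P[wt wt' wl].
exists (cycle3 t w t'); split.
- by rewrite odd_cycle3// eq_sym.
- by rewrite cycle3_move// eq_sym.
- move=> x xl; apply: cycle3_fix; rewrite !inE !negb_or.
  by apply/and3P; split; [move: tl|move: wl|move: t'l]; apply: contraNneq => <-.
Qed.

(** An even permutation is a product of an even number of transpositions, which are consumed two at
    a time. *)
Lemma even_perm_cycle3 (K : {group {perm T}}) :
  (forall x y z, x != y -> x != z -> y != z -> cycle3 x y z \in K) ->
  forall s, odd_perm s = false -> s \in K.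
Proof.
move=> K3 s.
have K2 x y z t : x != y -> z != t -> tperm x y * tperm z t \in K.
  have K2s u v w : u != v -> v != w -> tperm u v * tperm v w \in K.
    move=> uv vw; have [->|uw] := eqVneq u w; last exact: K3.
    by rewrite tpermC tperm2 group1.
  move=> xy zt; have [yz|yz] := eqVneq y z.
    by rewrite yz in xy *; exact: K2s.
  (* Inserting [tperm y z] twice leaves two products of transpositions with a common point. *)
  have -> : tperm x y * tperm z t =
      (tperm x y * tperm y z) * (tperm y z * tperm z t).
    by rewrite -mulgA (mulgA (tperm y z)) tperm2 mul1g.
  by rewrite groupM ?K2s.
have [ts -> ets] := prod_tpermP s.
have [m] := ubnP (size ts); elim: m ts ets => // m IH [|[x y] [|[z t] ts]] /=.
- by rewrite big_nil group1.
- rewrite /dpair /= => /andP[xy _] _.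
  by rewrite big_seq1 odd_tperm xy.
- rewrite /dpair /= => /and3P[xy zt ets] sz.
  rewrite !big_cons /= mulgA odd_permM odd_permM !odd_tperm xy zt addFb => o.
  by apply: groupM; [exact: K2|apply: IH => //; exact: ltnW].
Qed.

Lemma all_perm_cycle3 (K : {group {perm T}}) (s0 : {perm T}) :
  (forall s, odd_perm s = false -> s \in K) -> s0 \in K -> odd_perm s0 ->
  forall s, s \in K.
Proof.
move=> KA K0 o0 s; case os: (odd_perm s); last exact: KA.
by rewrite -(mulgK s0 s) groupM ?groupV// KA// odd_permM os o0.
Qed.

End EvenPermutations.

Section SlabPermutation.
Variables (Z C : finType).
Local Open Scope group_scope.

Definition slab_fun (c : C) (s : {perm Z}) (y : Z * C) : Z * C :=
  (if y.2 == c then s y.1 else y.1, y.2).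

Lemma slab_inj c s : injective (slab_fun c s).
Proof.
move=> [z c1] [z' c2]; rewrite /slab_fun /= => -[+ ec]; rewrite -ec.
by case: ifP => _; [move/perm_inj|] => ->.
Qed.

Definition slab c s : {perm Z * C} := perm (@slab_inj c s).

Lemma slabM c s t : slab c (s * t) = slab c s * slab c t.
Proof.
apply/permP => -[z c']; rewrite permM !permE /slab_fun /=.
by case: ifP; rewrite ?permM.
Qed.

Lemma odd_slab_square c s : odd_perm (slab c (s * s)) = false.
Proof. by rewrite slabM odd_permM addbb. Qed.

End SlabPermutation.

Section TwoCells.
Variables (Z A B : finType).
Hypothesis Z5 : 4 < #|Z|.
Local Open Scope group_scope.
Implicit Types (s t : {perm Z}) (P : B -> A -> bool).

Definition gate_fun P s (y : Z * B * A) : Z * B * A :=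
  (if P y.1.2 y.2 then s y.1.1 else y.1.1, y.1.2, y.2).

Lemma gate_inj P s : injective (gate_fun P s).
Proof.
move=> [[z b] a] [[z' b'] a']; rewrite /gate_fun /= => -[+ eb ea].
rewrite -eb -ea.
by case: ifP => _; [move/perm_inj|] => ->.
Qed.

Definition gate P s : {perm Z * B * A} := perm (@gate_inj P s).

Lemma gateM P s t : gate P (s * t) = gate P s * gate P t.
Proof.
apply/permP => -[[z b] a]; rewrite permM !permE /gate_fun /=.
by case: ifP; rewrite ?permM.
Qed.

Lemma gate1 P : gate P 1 = 1.
Proof.
by apply/permP => -[[z b] a]; rewrite !permE /gate_fun /= perm1 if_same.
Qed.

Lemma gateV P s : gate P s^-1 = (gate P s)^-1.
Proof. by apply: (mulgI (gate P s)); rewrite -gateM !mulgV gate1. Qed.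

(** Where only one of the predicates holds, one gate is trivial and the other cancels against its
    inverse. *)
Lemma gate_comm P P' s t :
  gate (fun b a => P b a && P' b a) [~ s, t] = [~ gate P s, gate P' t].
Proof.
rewrite [[~ gate _ _, _]](_ : _ = gate P s^-1 * (gate P' t^-1 *
  (gate P s * gate P' t))); last by rewrite !gateV.
apply/permP => -[[z b] a]; rewrite !permM !permE /gate_fun /=.
case: (P b a) (P' b a) => [] [] //=.
- by rewrite [[~ s, t]](_ : _ = s^-1 * (t^-1 * (s * t)))// !permM.
- by rewrite permKV.
- by rewrite permKV.
Qed.

Lemma gate_tperm b0 a0 z z' :
  gate (fun b a => (b == b0) && (a == a0)) (tperm z z') =
  tperm (z, b0, a0) (z', b0, a0).
Proof.
apply/permP => -[[z1 b] a]; rewrite !permE /gate_fun /= !xpair_eqE.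
have [->|bb] := eqVneq b b0; last by rewrite /= !andbF.
have [->|aa] := eqVneq a a0; last by rewrite /= !andbF.
by rewrite /= permE /= !andbT; case: ifP => // _; case: ifP.
Qed.

Variable K : {group {perm Z * B * A}}.
Hypothesis KB : forall (s : {perm Z * B}) (t : {perm Z * B * A}),
  odd_perm s = false -> (forall y, t y = (s y.1, y.2)) -> t \in K.
Hypothesis KA : forall (s : {perm Z * A}) (t : {perm Z * B * A}),
  odd_perm s = false ->
  (forall z b a, t (z, b, a) = ((s (z, a)).1, b, (s (z, a)).2)) -> t \in K.

Lemma extend_right (s : {perm Z * B}) : odd_perm s = false ->
  exists2 t : {perm Z * B * A}, t \in K & forall y, t y = (s y.1, y.2).
Proof.
move=> os; have inj : injective (fun y : Z * B * A => (s y.1, y.2)).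
  by move=> [p a] [p' a'] [/perm_inj -> ->].
by exists (perm inj) => [|y]; [apply: (KB os) => y|]; rewrite permE.
Qed.

Lemma extend_left (s : {perm Z * A}) : odd_perm s = false ->
  exists2 t : {perm Z * B * A}, t \in K &
    forall z b a, t (z, b, a) = ((s (z, a)).1, b, (s (z, a)).2).
Proof.
move=> os; pose f (y : Z * B * A) :=
  ((s (y.1.1, y.2)).1, y.1.2, (s (y.1.1, y.2)).2).
have inj : injective f.
  move=> [[z b] a] [[z' b'] a'] [/= e1 <- e2].
  have /perm_inj[-> ->//] : s (z, a) = s (z', a').
  by move: e1 e2; case: (s _) (s _) => [? ?] [? ?] /= -> ->.
exists (perm inj) => [|z b a]; last by rewrite permE.
by apply: (KA os) => z b a; rewrite permE.
Qed.

(* The commutator of a gate controlled by the first cell and a gate controlled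
   by the second one is controlled by both cells. *)
Lemma fiber_cycle3 b a z1 z2 z3 : z1 != z2 -> z1 != z3 -> z2 != z3 ->
  cycle3 (z1, b, a) (z2, b, a) (z3, b, a) \in K.
Proof.
move=> z12 z13 z23; rewrite /cycle3 -!gate_tperm -gateM.
have [s [t]] := cycle3_comm Z5 z12 z13 z23; rewrite /cycle3 => <-.
rewrite (gate_comm (fun b' _ => b' == b) (fun _ a' => a' == a)) groupR//.
  apply: (KB (odd_slab_square b s)) => -[[z b'] a'].
  by rewrite !permE.
apply: (KA (odd_slab_square a t)) => z b' a'.
by rewrite !permE.
Qed.

(** Conjugation by [h] gathers the points of a 3-cycle in one fiber over [(b, a)]. The coordinate in
    [B] is corrected first, then the one in [A]; since [z0] avoids [z1] and [z2], the moved point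
    never lands on a protected one. *)
Lemma move_to_fiber b a z1 z2 (t : Z * B * A) :
  t != (z1, b, a) -> t != (z2, b, a) ->
  exists2 h : {perm Z * B * A}, h \in K &
    [/\ h (z1, b, a) = (z1, b, a), h (z2, b, a) = (z2, b, a) &
        exists z, h t = (z, b, a)].
Proof.
case: t => -[z b'] a' t1 t2.
have cardP (C : finType) (c : C) : 4 < #|{: Z * C}|.
  rewrite card_prod (leq_trans Z5)// -[leqLHS]muln1 leq_mul//.
  by apply/card_gt0P; exists c.
have [z0] : {z0 | z0 \notin [:: z1; z2]}.
  by apply: fresh_point; exact: leq_trans Z5.
rewrite !inE !negb_or => /andP[z01 z02].
have [h1 Kh1 [h11 h12 [z' h1t]]] : exists2 h : {perm Z * B * A}, h \in K &
    [/\ h (z1, b, a) = (z1, b, a), h (z2, b, a) = (z2, b, a) &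
        exists z', h (z, b', a') = (z', b, a')].
  have [->|bb] := eqVneq b' b.
    by exists 1; rewrite ?group1//; split; rewrite ?perm1//; exists z.
  have [|||s [os st sf]] := @even_move _ [:: (z1, b); (z2, b)] (z, b') (z0, b).
  - exact: leq_trans (cardP _ b).
  - by rewrite !inE !xpair_eqE (negbTE bb) !andbF.
  - by rewrite !inE !xpair_eqE (negbTE z01) (negbTE z02).
  have [h Kh hE] := extend_right os; exists h => //.
  by split; rewrite !hE /= ?st ?sf ?inE ?eqxx ?orbT//; exists z0.
have [h2 Kh2 [h21 h22 [z'' h2t]]] : exists2 h : {perm Z * B * A}, h \in K &
    [/\ h (z1, b, a) = (z1, b, a), h (z2, b, a) = (z2, b, a) &
        exists z'', h (z', b, a') = (z'', b, a)].
  have [->|aa] := eqVneq a' a.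
    by exists 1; rewrite ?group1//; split; rewrite ?perm1//; exists z'.
  have [|||s [os st sf]] := @even_move _ [:: (z1, a); (z2, a)] (z', a') (z0, a).
  - exact: leq_trans (cardP _ a).
  - by rewrite !inE !xpair_eqE (negbTE aa) !andbF.
  - by rewrite !inE !xpair_eqE (negbTE z01) (negbTE z02).
  have [h Kh hE] := extend_left os; exists h => //.
  by split; rewrite !hE /= ?st ?sf ?inE ?eqxx ?orbT//; exists z0.
exists (h1 * h2); first exact: groupM.
by rewrite !permM h11 h21 h12 h22 h1t h2t; split => //; exists z''.
Qed.

Lemma fiber_cycle3_any b a z1 z2 (t : Z * B * A) : z1 != z2 ->
  t != (z1, b, a) -> t != (z2, b, a) ->
  cycle3 (z1, b, a) (z2, b, a) t \in K.
Proof.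
move=> z12 t1 t2; have [h Kh [h1 h2 [z ht]]] := move_to_fiber t1 t2.
rewrite -(groupJr _ Kh) cycle3J h1 h2 ht fiber_cycle3//.
- by apply: contraNneq t1 => zz; rewrite -(inj_eq (@perm_inj _ h)) ht h1 zz.
- by apply: contraNneq t2 => zz; rewrite -(inj_eq (@perm_inj _ h)) ht h2 zz.
Qed.

(** By conjugation, the second point of a 3-cycle joins the fiber of the first; the third point is
    then arbitrary, as in [fiber_cycle3_any]. *)
Lemma even_perm_two_cells (s : {perm Z * B * A}) :
  odd_perm s = false -> s \in K.
Proof.
apply: even_perm_cycle3 => {s} -[[z b] a] y t xy xt yt.
(* [move_to_fiber] protects two points, but only the first point of the cycle has to stay in place;
   [z0] supplies a second one different from [y]. *)
have [z0 z0z z0y] : exists2 z0, z0 != z & y != (z0, b, a).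
  have [z0] : {z0 | z0 \notin [:: z; y.1.1]}.
    by apply: fresh_point; exact: leq_trans Z5.
  rewrite !inE !negb_or => /andP[zz zy]; exists z0 => //.
  by apply: contraNneq zy => ->.
have yx : y != (z, b, a) by rewrite eq_sym.
have [h Kh [hx _ [z' hy]]] := move_to_fiber yx z0y.
rewrite -(groupJr _ Kh) cycle3J hx hy fiber_cycle3_any//.
- by apply: contraNneq yx => zz; rewrite -(inj_eq (@perm_inj _ h)) hx hy zz.
- by rewrite -[X in _ != X]hx (inj_eq (@perm_inj _ h)) eq_sym.
- by rewrite -hy (inj_eq (@perm_inj _ h)) eq_sym.
Qed.

End TwoCells.

(** * Parity of a permutation extended by one cell *)

Section OddExtension.
Variables (Z C : finType).
Local Open Scope group_scope.
Implicit Types s : {perm Z}.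

Lemma slab_tperm (c : C) (x y : Z) : slab c (tperm x y) = tperm (x, c) (y, c).
Proof.
apply/permP => -[z c']; rewrite !permE /slab_fun /= !xpair_eqE.
have [->|cc] := eqVneq c' c; last by rewrite !andbF.
by rewrite !andbT permE /=; case: ifP => // _; case: ifP.
Qed.

Lemma odd_slab (c : C) s : odd_perm (slab c s) = odd_perm s.
Proof.
have [ts -> _] := prod_tpermP s; elim: ts => [|[x y] ts IH].
  rewrite big_nil (_ : slab c 1 = 1) ?odd_perm1//.
  by apply: (mulgI (slab c 1)); rewrite -slabM !mulg1.
by rewrite big_cons slabM !odd_permM IH slab_tperm !odd_tperm xpair_eqE eqxx
   andbT.
Qed.

(** The extension is the product of one copy of [s] for each value of the new cell, and each copy
    has the parity of [s]. *)
Lemma odd_extend s (t : {perm Z * C}) :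
  (forall y, t y = (s y.1, y.2)) -> odd_perm t = odd_perm s && odd #|C|.
Proof.
move=> tE; have -> : t = \prod_(c <- enum C) slab c s.
  apply/permP => -[z c0]; rewrite tE /=.
  have : c0 \in enum C by rewrite mem_enum.
  suff prodE (r : seq C) : uniq r -> (\prod_(c <- r) slab c s) (z, c0) =
      (if c0 \in r then s z else z, c0) by rewrite prodE ?enum_uniq// => ->.
  elim: r z => [|c r IH] z /=; first by rewrite big_nil perm1.
  case/andP => cr ur; rewrite big_cons permM permE /slab_fun /= inE.
  case: eqP cr => [<- c0r|_ _]; rewrite IH//.
  by rewrite (negbTE c0r).
rewrite cardE; elim: (enum C) => [|c r IH].
  by rewrite big_nil odd_perm1 andbF.
rewrite big_cons odd_permM IH odd_slab /=.
by case: (odd_perm s) (odd _) => [] [].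
Qed.

Lemma extend_perm s : exists t : {perm Z * C}, forall y, t y = (s y.1, y.2).
Proof.
have inj : injective (fun y : Z * C => (s y.1, y.2)).
  by move=> [z c] [z' c'] /= [/perm_inj -> ->].
by exists (perm inj) => y; rewrite permE.
Qed.

End OddExtension.

(** * Closure properties of subgroups *)

Section Subgroups.
Variable G : groupType.
Implicit Types (S H : set G) (g h : G).
Local Open Scope classical_set_scope.

Lemma subgroup1 H : is_subgroup H -> H 1%g.
Proof. by case=> /set_mem. Qed.

Lemma subgroupM H g h : is_subgroup H -> H g -> H h -> H (g * h)%g.
Proof. by move=> /group_closedM Hm Hg Hh; apply/set_mem/Hm; exact: mem_set. Qed.

Lemma subgroupV H g : is_subgroup H -> H g -> H (g^-1)%g.
Proof. by move=> /group_closedV HV Hg; apply/set_mem/HV; exact: mem_set. Qed.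

Lemma generated_subgroupP S : is_subgroup (generated_subgroup S).
Proof.
split; first by apply/mem_set => M [Mg _]; exact: subgroup1.
move=> g h /set_mem Sg /set_mem Sh; apply/mem_set => M MS.
by case: (MS) => Mg _; apply: (subgroupM Mg (Sg _ MS) (subgroupV Mg (Sh _ MS))).
Qed.

End Subgroups.

(** * Local maps of the tape around the head *)

Section LocalMaps.
Variables d n k : nat.
Local Open Scope ring_scope.
Notation Zd := 'rV[int]_d.
Notation Sigma := 'I_n.
Notation local_config := ((Zd -> Sigma) * state k)%type.
Implicit Types (c : local_config) (f g : local_config -> local_config).
Implicit Types (s : seq Zd) (u v w t : Zd).

(* The tape is seen from the head, which is at the origin. *)
Definition lift f (c : config d n k) : config d n k :=
  match pselect (exists v, sval c.2 v != ord0) with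
  | left ex =>
    let v := cid ex in
    let y := f (fun t => c.1 (projT1 v + t),
                exist _ (sval c.2 (projT1 v)) (projT2 v)) in
    (fun t => y.1 (t - projT1 v), head_at (projT1 v) y.2)
  | right _ => c
  end.

Lemma lift_no_head f (x : Zd -> Sigma) (y : head_config d k) :
  (forall v, sval y v = ord0) -> lift f (x, y) = (x, y).
Proof.
rewrite /lift => y0; case: pselect => //= ex.
by exfalso; case: ex => v; rewrite y0 eqxx.
Qed.

Lemma lift_head_at f x v q : lift f (x, head_at v q) =
  let y := f (fun t => x (v + t), q) in (fun t => y.1 (t - v), head_at v y.2).
Proof.
rewrite /lift; case: pselect => /= [ex|]; last first.
  by case; exists v; rewrite eqxx; case: q.
case: (cid ex) => w /= yw; have ewv : w = v.
  by move: yw; case: (w =P v) => //; rewrite eqxx.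
rewrite (_ : exist _ _ _ = q) ?ewv//.
by apply: val_inj; rewrite /= ewv eqxx.
Qed.

Lemma eq_on_heads (F F' : config d n k -> config d n k) :
  (forall x (y : head_config d k), (forall v, sval y v = ord0) ->
     F (x, y) = F' (x, y)) ->
  (forall x v q, F (x, head_at v q) = F' (x, head_at v q)) -> F = F'.
Proof.
move=> F0 F1; apply/funext => -[x y].
by have [y0|[v [q ->]]] := head_configP y; [exact: F0|exact: F1].
Qed.

Lemma lift_id : lift id = id.
Proof.
apply: eq_on_heads => [x y y0|x v q]; first by rewrite lift_no_head.
by rewrite lift_head_at /=; congr pair; apply/funext => t; rewrite addrC subrK.
Qed.

Lemma lift_comp f g : lift (f \o g) = lift f \o lift g.
Proof.
apply: eq_on_heads => [x y y0|x v q]; first by rewrite /= !lift_no_head.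
rewrite /= !lift_head_at /=.
rewrite (_ : (fun t => _ (v + t - v)) = (g (fun t => x (v + t), q)).1).
  by rewrite -surjective_pairing.
by apply/funext => t; rewrite addrC addKr.
Qed.

(** A local configuration can be recovered from the configuration that has its head at the
    origin. *)
Lemma lift_inj f : injective (lift f) -> injective f.
Proof.
move=> finj c c' fc.
have E (c1 : local_config) : (fun t => c1.1 (0 + t), c1.2) = c1.
  by case: c1 => x q; congr pair; apply/funext => t; rewrite add0r.
have /finj [ex eq0] : 
    lift f (c.1, head_at 0 c.2) = lift f (c'.1, head_at 0 c'.2).
  by rewrite !lift_head_at /= !E fc.
case: c c' ex eq0 {fc} => [x q] [x' q'] /= -> eq0; congr pair; apply: val_inj.
by have := congr1 (fun h => h 0) eq0; rewrite eqxx.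
Qed.

Definition translate w c : local_config := (fun t => c.1 (w + t), c.2).

Lemma lift_translate f w :
  lift (translate (- w) \o f \o translate w) =
  turing_map (shift_rule n k (- w)) \o lift f \o turing_map (shift_rule n k w).
Proof.
apply: eq_on_heads => [x y y0|x v q].
  by rewrite /= turing_map_no_head// !lift_no_head// turing_map_no_head.
rewrite /= shift_head_at !lift_head_at shift_head_at addrK /= /translate /=.
have -> : (fun t => x (v + w + t)) = (fun t => x (v + (w + t))).
  by apply/funext => t; rewrite addrA.
by congr pair; apply/funext => t; rewrite addrC opprD addrA.
Qed.

Definition permute (p : Zd -> Zd) c : local_config := (c.1 \o p, c.2).

Definition agree s c c' := c.2 = c'.2 /\ {in s, c.1 =1 c'.1}.

(** The second condition compares images on [s] only, since the first one already determines them
    elsewhere. *)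
Definition local s f :=
  (forall c t, t \notin s -> (f c).1 t = c.1 t) /\
  (forall c c', agree s c c' -> agree s (f c) (f c')).

Lemma local_sub s s' f : {subset s <= s'} -> local s f -> local s' f.
Proof.
move=> ss' [fout fin]; split=> [c t ts'|c c' [eq2 eq1]].
  by apply: fout; apply: contra ts'; exact: ss'.
have [fq fs] := fin c c' (conj eq2 (fun t ts => eq1 t (ss' t ts))).
split=> // t ts'; have [/fs//|ts] := boolP (t \in s).
by rewrite !fout//; exact: eq1.
Qed.

(** Nested pairs, with the state innermost, make a window with one or two more cells definitionally
    a product [Z * C] or [Z * B * A], so that the results on permutations of products apply
    directly. *)
Fixpoint pattern m : finType :=
  if m is m'.+1 then (pattern m' * Sigma)%type : finType else state k : finType.

Fixpoint get s c : pattern (size s) :=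
  match s with [::] => c.2 | u :: s' => (get s' c, c.1 u) end.

Fixpoint put s c : pattern (size s) -> local_config :=
  match s return pattern (size s) -> local_config with
  | [::] => fun q => (c.1, q)
  | u :: s' => fun y => let c' := put c y.1 in
                        (fun t => if t == u then y.2 else c'.1 t, c'.2)
  end.

Definition act s (h : pattern (size s) -> pattern (size s)) c :=
  put c (h (get s c)).

Lemma get_agree s c c' : get s c = get s c' <-> agree s c c'.
Proof.
elim: s => [|u s IH] /=; first by split=> [|[]].
split=> [[/IH[e2 e1] eu]|[e2 e1]].
  by split=> // t; rewrite inE => /predU1P[->|/e1].
congr pair; last by apply: e1; rewrite mem_head.
by apply/IH; split=> // t ts; apply: e1; rewrite inE ts orbT.
Qed.

Lemma put_out s c (y : pattern (size s)) t :
  t \notin s -> (put c y).1 t = c.1 t.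
Proof.
elim: s y => [|u s IH] //= y; rewrite inE negb_or => /andP[/negbTE-> ts].
exact: IH.
Qed.

Lemma get_put s c (y : pattern (size s)) : uniq s -> get s (put c y) = y.
Proof.
elim: s y => [|u s IH] //= [y a] /andP[us uniqs]; rewrite eqxx.
congr pair; rewrite -[RHS]IH//; apply/get_agree; split=> //= t ts.
by case: eqP => // tu; rewrite tu (negbTE us) in ts.
Qed.

Lemma window_ext s c c' :
  get s c = get s c' -> (forall t, t \notin s -> c.1 t = c'.1 t) -> c = c'.
Proof.
move=> /get_agree[e2 e1] e3; case: c c' e1 e2 e3 => [x q] [x' q'] /= e1 -> e3.
by congr pair; apply/funext => t; have [/e1|/e3] := boolP (t \in s).
Qed.

Lemma act_out s h c t : t \notin s -> (@act s h c).1 t = c.1 t.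
Proof. exact: put_out. Qed.

Lemma get_act s h c : uniq s -> get s (@act s h c) = h (get s c).
Proof. exact: get_put. Qed.

Lemma act_eq s h f : uniq s -> (forall c, get s (f c) = h (get s c)) ->
  (forall c t, t \notin s -> (f c).1 t = c.1 t) -> act h = f.
Proof.
move=> us fin fout; apply/funext => c; apply: (@window_ext s).
  by rewrite get_act ?fin.
by move=> t ts; rewrite act_out ?fout.
Qed.

Lemma act_id s : uniq s -> @act s id = id.
Proof. by move=> us; apply: act_eq. Qed.

Lemma act_comp s h h' : uniq s -> @act s (h \o h') = act h \o act h'.
Proof.
by move=> us; apply: act_eq => //= c => [|t ts]; rewrite ?get_act// !act_out.
Qed.

Lemma act_cons u s (h : pattern (size s) -> pattern (size s))
    (h' : pattern (size (u :: s)) -> pattern (size (u :: s))) :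
  uniq (u :: s) -> (forall y, h' y = (h y.1, y.2)) -> act h' = act h.
Proof.
move=> us h'E; have /andP[uns uniqs] := us; apply: act_eq => //= c => [|t].
  by rewrite get_act// act_out// h'E.
by rewrite inE negb_or => /andP[_ ts]; rewrite act_out.
Qed.

(** The cell [v] is a spectator, stored between the pattern of [s] and the value of [u]; this is the
    shape of the hypothesis [KA] above. *)
Lemma act_cons2 u v s (h : pattern (size (u :: s)) -> pattern (size (u :: s)))
    (h' : pattern (size (u :: v :: s)) -> pattern (size (u :: v :: s))) :
  uniq (u :: v :: s) ->
  (forall (z : pattern (size s)) (b a : Sigma),
     h' (z, b, a) = ((h (z, a)).1, b, (h (z, a)).2)) ->
  act h' = act h.
Proof.
move=> us h'E; have /and3P[] := us; rewrite inE negb_or.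
move=> /andP[uv uns] vns uniqs.
have us' : uniq (u :: s) by rewrite /= uns.
apply: act_eq => // c => [|t].
  rewrite [RHS]h'E -[(get s c, c.1 u)]/(get (u :: s) c) -get_act//=.
  by rewrite [v == u]eq_sym (negbTE uv) put_out.
by rewrite !inE !negb_or => /and3P[tu _ ts]; rewrite act_out// inE negb_or tu.
Qed.

Lemma act_local s h : uniq s -> local s (@act s h).
Proof.
move=> us; split=> [c t|c c' /get_agree cc']; first exact: act_out.
by apply/get_agree; rewrite !get_act// cc'.
Qed.

(** On the finite set of patterns [f] induces an injective, hence bijective, map. The configuration
    [c0] only fills the cells outside the window. *)
Lemma local_act c0 s f : uniq s -> injective f -> local s f ->
  exists h : {perm pattern (size s)}, f = act h.
Proof.
move=> us finj [fout fin].
pose h (y : pattern (size s)) := get s (f (put c0 y)).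
have fE : act h = f.
  apply: act_eq => // c; apply/get_agree/fin/get_agree.
  by rewrite get_put.
have hinj : injective h.
  move=> y y' ehy; rewrite -(get_put c0 y us) -(get_put c0 y' us).
  congr (get s _); apply/finj/(window_ext ehy) => t ts.
  by rewrite !fout// !put_out.
exists (perm hinj); rewrite -fE; congr act.
by apply/funext => y; rewrite permE.
Qed.

End LocalMaps.

(** * Generation by permutations of small windows *)

Section Generation.
Variables d n k : nat.
Local Open Scope ring_scope.
Notation Zd := 'rV[int]_d.
Notation Sigma := 'I_n.
Notation local_config := ((Zd -> Sigma) * state k)%type.
Implicit Types (c : local_config) (f g : local_config -> local_config).
Implicit Types (s : seq Zd) (u v w t : Zd).

Definition swap u v t := if t == u then v else if t == v then u else t.

(** This serves twice: to obtain all shifts from the unit ones, and to join any two cells by unit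
    steps. *)
Lemma lattice_ind (P : Zd -> Prop) :
  P 0 -> (forall v w, P v -> P w -> P (v + w)) -> (forall v, P v -> P (- v)) ->
  (forall i, P (delta_mx 0 i)) -> forall v, P v.
Proof.
move=> P0 PD PN Pi v; rewrite (matrix_sum_delta v) big_ord1.
have PZ (m : nat) w : P w -> P (m%:Z *: w).
  move=> Pw; elim: m => [|m IH]; first by rewrite scale0r.
  by rewrite intS scalerDl scale1r; exact: PD.
apply: (big_ind P) => // i _; case: (v 0 i) => m; first exact: PZ.
by rewrite NegzE scaleNr; apply/PN/PZ.
Qed.

Lemma swapL u v : swap u v u = v. Proof. by rewrite /swap eqxx. Qed.

Lemma swapR u v : swap u v v = u.
Proof. by rewrite /swap; case: eqP => [->|]; rewrite ?eqxx. Qed.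

Lemma swapD u v t : t != u -> t != v -> swap u v t = t.
Proof. by rewrite /swap => /negbTE-> /negbTE->. Qed.

Lemma swapK u v : involutive (swap u v).
Proof.
move=> t; have [->|tu] := eqVneq t u; first by rewrite swapL swapR.
have [->|tv] := eqVneq t v; first by rewrite swapR swapL.
by rewrite !swapD.
Qed.

Lemma swapC u v : swap u v = swap v u.
Proof.
apply/funext => t; have [->|tu] := eqVneq t u; first by rewrite swapL swapR.
have [->|tv] := eqVneq t v; first by rewrite swapR swapL.
by rewrite !swapD.
Qed.

Lemma swap_conj u v w : w != u -> w != v ->
  swap u v \o swap v w \o swap u v = swap u w.
Proof.
move=> wu wv; apply/funext => t /=; have [->|tu] := eqVneq t u.
  by rewrite !swapL swapD.
have [->|tw] := eqVneq t w; first by rewrite swapR (swapD wu wv) !swapR.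
have [tv|tv] := eqVneq t v.
  rewrite tv in tu tw; rewrite tv swapR [RHS]swapD//.
  by rewrite (@swapD v w u) ?swapL// eq_sym.
by rewrite !(swapD, tu, tv, tw).
Qed.

(** In positive dimension the diagonal is an unlimited supply of distinct cells. *)
Lemma uniq_diagonal m : (0 < d)%N ->
  uniq (mkseq (fun i : nat => const_mx i%:Z : Zd) m).
Proof.
move=> d_gt0; apply: mkseq_uniq => i j /matrixP /(_ 0 (Ordinal d_gt0)).
by rewrite !mxE => -[].
Qed.

Lemma fresh_cell s : (0 < d)%N -> exists u, u \notin s.
Proof.
move=> d_gt0; pose r := mkseq (fun i : nat => const_mx i%:Z : Zd) (size s).+1.
have [/allP rs|/allPn[u _ us]] := boolP (all [in s] r); last by exists u.
by have := uniq_leq_size (uniq_diagonal _ d_gt0) rs; rewrite size_mkseq ltnn.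
Qed.

Lemma card_pattern m : #|pattern n k m| = (#|{: state k}| * n ^ m)%N.
Proof.
elim: m => [|m IH] /=; first by rewrite muln1.
by rewrite card_prod IH card_ord expnSr mulnA.
Qed.

Section Words.
Variable H : set (bijection (config d n k)).
Hypothesis sgH : is_subgroup H.

Definition realized f := exists2 g, H g & bij_fun g = lift f.

Lemma realized_id : realized id.
Proof. by exists 1%g; [exact: subgroup1|rewrite lift_id]. Qed.

Lemma realized_comp f g : realized f -> realized g -> realized (f \o g).
Proof.
move=> [f' Hf ef] [g' Hg eg]; exists (f' * g')%g; first exact: subgroupM.
by rewrite lift_comp -ef -eg.
Qed.

Hypothesis shifts : forall v,
  exists2 g, H g & bij_fun g = turing_map (shift_rule n k v).

Lemma realized_translate f w :
  realized f -> realized (translate (- w) \o f \o translate w).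
Proof.
move=> [f' Hf ef]; have [g1 Hg1 e1] := shifts w.
have [g2 Hg2 e2] := shifts (- w).
exists (g2 * f' * g1)%g; first by apply: subgroupM => //; exact: subgroupM.
by rewrite lift_translate -ef -e1 -e2.
Qed.

Definition all_perms s :=
  forall h : {perm pattern n k (size s)}, realized (act h).

Definition even_perms s :=
  forall h : {perm pattern n k (size s)},
    odd_perm h = false -> realized (act h).

(** Unlike [all_perms], this does not depend on the order in which [s] lists its cells, and it
    passes to smaller windows by [local_sub], which suits the transport of windows. *)
Definition all_local s := forall f, injective f -> local s f -> realized f.

Lemma all_perms_local c0 s : uniq s -> all_perms s -> all_local s.
Proof. by move=> us H_s f finj /(local_act c0 us finj)[h ->]. Qed.

Lemma act_inj s (h : {perm pattern n k (size s)}) : uniq s -> injective (act h).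
Proof.
move=> us; apply: (@can_inj _ _ _ (act (h^-1)%g)) => c.
rewrite -[LHS]/((act _ \o act _) c) -act_comp//.
by rewrite (_ : _ \o _ = id) ?act_id//; apply/funext => y /=; rewrite permK.
Qed.

Lemma all_local_perms s : uniq s -> all_local s -> all_perms s.
Proof. by move=> us Hs h; apply: Hs; [exact: act_inj|exact: act_local]. Qed.

(** * Transport of windows by swaps of cells *)

Section Swaps.
Hypothesis unit_swaps : forall i, all_local [:: 0; delta_mx 0 i].

Definition swappable u v := realized (permute (swap u v)).

Lemma permute_swapK u v : involutive (@permute d n k (swap u v)).
Proof.
move=> [x q]; rewrite /permute /=; congr pair.
by apply/funext => t /=; rewrite swapK.
Qed.

Lemma swappable_refl u : swappable u u.
Proof.
rewrite /swappable (_ : permute _ = id); first exact: realized_id.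
apply/funext => -[x q]; rewrite /permute /=; congr pair; apply/funext => t /=.
by rewrite /swap; case: eqP => [->|].
Qed.

Lemma swappable_trans u v w : swappable u v -> swappable v w -> swappable u w.
Proof.
move=> Huv Hvw; have [->|wu] := eqVneq w u; first exact: swappable_refl.
have [->//|wv] := eqVneq w v.
rewrite /swappable -(swap_conj wu wv).
by have := realized_comp Huv (realized_comp Hvw Huv); congr realized.
Qed.

Lemma swappable_unit w i : swappable w (w + delta_mx 0 i).
Proof.
have : realized (permute (swap 0 (delta_mx 0 i))).
  apply: (unit_swaps (i := i)); first exact: (can_inj (@permute_swapK _ _)).
  split=> [c t|c c' [e2 e1]].
    by rewrite !inE negb_or => /andP[t0 ti] /=; rewrite swapD.
  split=> //= t; rewrite !inE => /orP[]/eqP->; rewrite ?swapL ?swapR.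
    by rewrite e1// !inE eqxx orbT.
  by rewrite e1// !inE eqxx.
(* Conjugation by the shift carries the swap of [0] and the unit vector to the cell [w]. *)
move=> /(realized_translate w).
congr realized; apply/funext => -[x q]; rewrite /permute /translate /=.
congr pair; apply/funext => t /=; congr x.
rewrite /swap [- w + t]addrC subr_eq0 subr_eq [delta_mx 0 i + w]addrC.
by case: eqP => // _; case: eqP => _; rewrite ?addr0 ?subrKC.
Qed.

Lemma swappable_all u v : swappable u v.
Proof.
(* Induction on the difference of the two cells: sums use transitivity of [swappable], opposites its
   symmetry. *)
suff Hw w : forall u, swappable u (u + w) by rewrite -(subrKC u v).
elim/lattice_ind: w => {u v} [u|v w Hv Hw u|v Hv u|i u].
- by rewrite addr0; exact: swappable_refl.
- by rewrite addrA; exact: swappable_trans (Hv _) (Hw _).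
- by have := Hv (u - v); rewrite subrK /swappable swapC.
- exact: swappable_unit.
Qed.

Lemma all_local_swap u v s : all_local s -> all_local (map (swap u v) s).
Proof.
move=> Hs f finj [fout fin]; pose p := @permute d n k (swap u v).
have pK : involutive p := @permute_swapK u v.
have -> : f = p \o (p \o f \o p) \o p by apply/funext => c /=; rewrite !pK.
have Hp : realized p by exact: swappable_all.
apply: (realized_comp (realized_comp Hp _) Hp); apply: Hs.
  exact: inj_comp (inj_comp (can_inj pK) finj) (can_inj pK).
split=> [c t ts|c c' [e2 e1]].
  rewrite /= fout /=; first by rewrite swapK.
  by rewrite mem_map//; exact: (can_inj (@swapK u v)).
have [|fe2 fe1] := fin (p c) (p c').
  by split=> //= _ /mapP[t ts ->]; rewrite /= swapK e1.
by split=> // t ts; apply: fe1; exact: map_f.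
Qed.

(** The cells are put in place from the last to the first; the swap that places [u] fixes the cells
    already placed. The transport is claimed for every window [r] because the map built for the tail
    must also be applied to [u :: s]. *)
Lemma move_window s s' : size s = size s' -> uniq s -> uniq s' ->
  exists p : Zd -> Zd, [/\ injective p, map p s = s' &
                       forall r, all_local r -> all_local (map p r)].
Proof.
elim: s s' => [|u s IH] [|v s'] //=.
  by move=> _ _ _; exists id; split=> // r; rewrite map_id.
move=> [ss] /andP[us uniqs] /andP[vs uniqs'].
have [p [pinj ps pH]] := IH _ ss uniqs uniqs'.
exists (swap (p u) v \o p); split.
- by apply: inj_comp pinj; exact: (can_inj (@swapK _ _)).
- rewrite /= swapL map_comp ps; congr cons.
  rewrite -[RHS]map_id; apply/eq_in_map => t ts'; rewrite swapD//.
  + by apply: contraNneq us => tpu; rewrite -(mem_map pinj) ps -tpu.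
  + by apply: contraNneq vs => <-.
- by move=> r /pH /(@all_local_swap (p u) v); rewrite map_comp.
Qed.

Lemma all_local_size s s' : size s = size s' -> uniq s -> uniq s' ->
  all_local s -> all_local s'.
Proof.
by move=> ss us us' Hs; have [p [_ <- +]] := move_window ss us us'; exact.
Qed.

End Swaps.

Lemma realized_group_set s : uniq s ->
  group_set [set h : {perm pattern n k (size s)} | `[< realized (act h) >]].
Proof.
move=> us; apply/group_setP; split.
  rewrite inE; apply/asboolP.
  rewrite (_ : act _ = id); first exact: realized_id.
  by rewrite -(@act_id d n k s)//; congr act; apply/funext => y; rewrite perm1.
move=> g h; rewrite !inE => /asboolP Hg /asboolP Hh; apply/asboolP.
(* Permutations compose from left to right and functions from right to left, hence the reversed
   order. *)
rewrite (_ : act _ = act h \o act g); first exact: realized_comp.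
by rewrite -act_comp//; congr act; apply/funext => y; rewrite permM.
Qed.

Definition realized_perms s (us : uniq s) :
    {group {perm pattern n k (size s)}} :=
  Group (realized_group_set us).

Lemma mem_realized s (us : uniq s) (h : {perm pattern n k (size s)}) :
  reflect (realized (act h)) (h \in realized_perms us).
Proof. by rewrite inE; exact: asboolP. Qed.

(** The two-cell criterion applies with the patterns of [s] as [Z], the values of [v] as [B] and
    those of [u] as [A]. *)
Lemma even_perms_step u v s : uniq (u :: v :: s) ->
  (4 < #|pattern n k (size s)|)%N ->
  even_perms (u :: s) -> even_perms (v :: s) -> even_perms (u :: v :: s).
Proof.
move=> us Z5 Hu Hv h oh; apply/(mem_realized us).
apply: (even_perm_two_cells Z5 _ _ oh) => g t og tE; apply/(mem_realized us).
  by rewrite (act_cons us tE); exact: Hv.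
by rewrite (act_cons2 us tE); exact: Hu.
Qed.

(** Extended to the cell [u], the permutation [h] becomes [n] copies of itself, an even number of
    them. *)
Lemma all_perms_even_base u s : ~~ odd n -> uniq (u :: s) ->
  even_perms (u :: s) -> all_perms s.
Proof.
move=> on us Hu h; have [t tE] := extend_perm 'I_n h.
rewrite -(act_cons us tE); apply: Hu.
by rewrite (odd_extend tE) card_ord (negbTE on) andbF.
Qed.

(** A transposition of two patterns of [s] extends to [n] disjoint transpositions. This odd
    permutation, together with the even ones, generates all of them. *)
Lemma all_perms_odd_base u s : odd n -> uniq (u :: s) ->
  (1 < #|pattern n k (size s)|)%N ->
  all_perms s -> even_perms (u :: s) -> all_perms (u :: s).
Proof.
move=> on us /card_gt1P[x [y [_ _ xy]]] Hs Hu h.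
have [t tE] := extend_perm 'I_n (tperm x y).
apply/(mem_realized us).
apply: (all_perm_cycle3 (K := realized_perms us) (s0 := t)).
- by move=> g og; apply/mem_realized; exact: Hu.
- by apply/mem_realized; rewrite (act_cons us tE); exact: Hs.
- by rewrite (odd_extend tE) odd_tperm xy card_ord on.
Qed.

(** * Induction on the size of the window *)

Section Windows.
Variables (c0 : local_config) (s0 : seq Zd).
Hypotheses (d_gt0 : (0 < d)%N) (us0 : uniq s0) (size_s0 : size s0 = 4).
Hypothesis unit_swaps : forall i, all_local [:: 0; delta_mx 0 i].
Hypothesis perms_s0 : all_perms s0.

Lemma all_perms_size4 s : uniq s -> size s = 4 -> all_perms s.
Proof.
move=> us ss; apply: all_local_perms => //.
apply: (all_local_size unit_swaps (s := s0)) => //; first by rewrite size_s0.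
exact: (all_perms_local c0).
Qed.

Lemma even_perms_large s :
  (1 < n)%N -> uniq s -> (3 < size s)%N -> even_perms s.
Proof.
move=> n_gt1; move: {-1}(size s) (erefl (size s)) => m.
elim: m s => [|m IH] s ss us; first by [].
rewrite leq_eqVlt => /predU1P[m3|m4].
  by move=> h _; apply: all_perms_size4; rewrite // ss.
case: s ss us => [|u [|v s]] //= [ss] us; first by rewrite -ss in m4.
have /and3P[] := us; rewrite inE negb_or.
move=> /andP[uv uns] vns uniqs.
apply: even_perms_step => //.
(* The window has at least five cells, so at least three remain without [u] and [v]; they give eight
   patterns, enough for the five points of [cycle3_comm]. This is why the induction starts at four
   cells. *)
- rewrite card_pattern (@leq_trans (2 ^ 3))//.
  rewrite -[leqLHS]mul1n leq_mul//; first by apply/card_gt0P; exists c0.2.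
  apply: (@leq_trans (2 ^ size s)); last by rewrite leq_exp2r//; lia.
  by rewrite leq_exp2l//; lia.
- by apply: IH => //=; rewrite uns.
- by apply: IH => //=; rewrite vns.
Qed.

Lemma all_perms_large s : (1 < n)%N -> uniq s -> (3 < size s)%N -> all_perms s.
Proof.
move=> n_gt1; case: (boolP (odd n)) => on; last first.
  (* For even [n], one extra cell makes every permutation of the window even. *)
  move=> us ss; have [u us'] := fresh_cell s d_gt0.
  apply: (@all_perms_even_base u) => //=; first by rewrite us'.
  by apply: even_perms_large => //=; [rewrite us'|rewrite ltnW].
(* For odd [n], an odd permutation is inherited from the window with one cell fewer, down to four
   cells. *)
elim: s => // u s IH us; rewrite /= leq_eqVlt => /predU1P[s4|s4].
  by apply: all_perms_size4 => //; rewrite /= -s4.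
have /= /andP[uns uniqs] := us.
apply: all_perms_odd_base => //.
- rewrite card_pattern (@leq_trans (2 ^ 1))// -[leqLHS]mul1n leq_mul//.
    by apply/card_gt0P; exists c0.2.
  apply: (@leq_trans (2 ^ size s)); first by rewrite leq_exp2l//; lia.
  by rewrite leq_exp2r//; lia.
- exact: IH.
- by apply: even_perms_large => //=; exact: ltnW.
Qed.

Lemma all_local_large s : uniq s -> (3 < size s)%N -> all_local s.
Proof.
move=> us ss; have [n1|n_gt1] := leqP n 1; last first.
  by apply: (all_perms_local c0) => //; exact: all_perms_large.
(* With at most one symbol the tape carries no information: [f] acts on the state alone, and is
   therefore local on [s0] as well. *)
have Sigma1 (a b : Sigma) : a = b.
  by apply: val_inj; case: a b => [[|a] ?] [[|b] ?] //=; lia.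
move=> f finj [fout fin]; apply: (all_perms_local c0 us0 perms_s0 finj).
split=> [c t _|c c' [eq2 _]]; first exact: Sigma1.
by split=> //; have [] := fin c c' (conj eq2 (fun t _ => Sigma1 _ _)).
Qed.

End Windows.

End Words.
End Generation.

(** * Oblivious machines *)

Section Oblivious.
Variables d n k : nat.
Local Open Scope ring_scope.
Notation Zd := 'rV[int]_d.
Notation Sigma := 'I_n.
Notation local_config := ((Zd -> Sigma) * state k)%type.
Implicit Types (c : local_config) (f : local_config -> local_config).
Implicit Types (s : seq Zd) (u v w t : Zd).

Lemma LP_local g : LP d n k g ->
  exists f s, [/\ uniq s, injective f, local s f & bij_fun g = lift f].
Proof.
move=> [_ [r [gE r0]]].
pose f c : local_config :=
  let y := (lr_fun r ([ffun u => c.1 (val u)], c.2)).1 in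
  (fun t => if insub t is Some u then y.1 u else c.1 t, y.2).
have liftE : bij_fun g = lift f.
  rewrite gE; apply: eq_on_heads => [x y y0|x v q].
    by rewrite turing_map_no_head// lift_no_head.
  rewrite turing_map_head_at lift_head_at /step /f /=.
  case: (lr_fun r _) (r0 ([ffun u => x (v + val u)], q)) => [[p' q'] e] /= ->.
  rewrite addr0; congr pair; apply/funext => t.
  by case: insubP => //= _; rewrite subrKC.
(* The rule reads one window and writes another; it is local on their union. *)
exists f, (undup (enum_fset (lr_in r) ++ enum_fset (lr_out r))); split=> //.
- exact: undup_uniq.
- by apply: lift_inj; rewrite -liftE; exact: (can_inj (bij_funK g)).
- split=> [c t|c c' [e2 e1]].
    rewrite mem_undup mem_cat negb_or => /andP[_ tout] /=.
    by case: insubP => // u tF; rewrite tF in tout.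
  have e : [ffun u : lr_in r => c.1 (val u)] = [ffun u => c'.1 (val u)].
    apply/ffunP => u; rewrite !ffunE e1// mem_undup mem_cat.
    by apply/orP; left; exact: (valP u).
  rewrite /f e e2; split=> //= t ts; case: insubP => // _; exact: e1.
Qed.

Lemma local_rule_exists c0 s f : local s f ->
  exists r : local_rule d n k,
    turing_map r = lift f /\ forall pq, (lr_fun r pq).2 = 0.
Proof.
move=> [fout fin]; pose F := [fset t in s]%fset.
have FE t : (t \in F) = (t \in s) by rewrite in_fset.
(* Outside [F] the tape is completed by the symbols of [c0]; by locality the state and the symbols
   written in [F] do not depend on this choice. *)
pose tape (p : {ffun F -> Sigma}) t :=
  if insub t is Some u then p u else c0.1 t.
pose r := @LocalRule d n k F F (fun pq =>
  let y := f (tape pq.1, pq.2) in ([ffun u => y.1 (val u)], y.2, 0)).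
exists r; split=> //; apply: eq_on_heads => [x y y0|x v q].
  by rewrite turing_map_no_head// lift_no_head.
rewrite turing_map_head_at lift_head_at /step /= addr0.
pose p : {ffun F -> Sigma} := [ffun u => x (v + fsval u)]; rewrite -/p.
have [|/= -> fE] := fin (tape p, q) (fun t => x (v + t), q).
  split=> //= t; rewrite -FE /tape => tF.
  case: insubP => [u _ ut|]; last by rewrite tF.
  by rewrite ffunE ut.
congr pair; apply/funext => t; case: insubP => [u uF ut|tF].
  by rewrite ffunE fE ut// -FE.
by rewrite fout -?FE//= subrKC.
Qed.

Lemma act_LP c0 s (h : {perm pattern n k (size s)}) : uniq s ->
  exists2 g, LP d n k g & bij_fun g = lift (act h).
Proof.
move=> us; have hK (h1 h2 : {perm pattern n k (size s)}) : h2 = (h1^-1)%g ->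
    cancel (lift (act h1)) (lift (@act d n k s h2)).
  move=> -> c; rewrite -[LHS]/((lift _ \o lift _) c) -lift_comp -act_comp//.
  rewrite (_ : _ \o _ = id) ?act_id ?lift_id//.
  by apply/funext => y /=; rewrite permK.
have hV : cancel (lift (act (h^-1)%g)) (lift (@act d n k s h)).
  by apply: hK; rewrite invgK.
have [r [rE r0]] := local_rule_exists c0 (act_local h us).
have [r' [r'E _]] := local_rule_exists c0 (act_local (h^-1)%g us).
exists (Bijection (hK _ _ erefl) hV) => //; split; last by exists r.
by split; [exists r|exists r'].
Qed.

Definition unit_shifts : set (bijection (config d n k)) :=
  [set g | exists i,
    bij_fun g = turing_map (shift_rule n k (delta_mx 0 i))]%classic.

Definition window_perms s : set (bijection (config d n k)) :=
  [set g | exists h : {perm pattern n k (size s)},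
    bij_fun g = lift (act h)]%classic.

Lemma finite_bijections (X : Type) (I : finType) (F : I -> X -> X) :
  finite_set [set g : bijection X | exists i, bij_fun g = F i]%classic.
Proof.
(* An [F i] that is not the map of a bijection is sent to the default value [1]; the image of [G]
   still contains all the bijections in question. *)
pose G i : bijection X :=
  if pselect (exists g, bij_fun g = F i) is left ex then projT1 (cid ex)
  else 1%g.
apply: (@sub_finite_set _ _ (G @` [set: I])%classic).
  move=> g [i gE]; exists i => //; rewrite /G.
  case: pselect => [ex|]; last by case; exists g.
  by case: (cid ex) => g' /= g'E; apply: bijection_eqP; rewrite g'E.
exact/finite_image/finite_finset.
Qed.

Lemma shifts_of_units (H : set (bijection (config d n k))) : is_subgroup H ->
  (unit_shifts `<=` H)%classic ->
  forall v, exists2 g, H g & bij_fun g = turing_map (shift_rule n k v).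
Proof.
move=> sgH HU; apply: lattice_ind => [|v w [g Hg gE] [h Hh hE]|v [g Hg gE]|i].
- exists 1%g; first exact: subgroup1.
  apply: eq_on_heads => [x y y0|x v q]; first by rewrite turing_map_no_head.
  by rewrite shift_head_at addr0.
- exists (h * g)%g; first exact: subgroupM.
  rewrite -[LHS]/(bij_fun h \o bij_fun g) gE hE.
  apply: eq_on_heads => [x y y0|x u q]; first by rewrite /= !turing_map_no_head.
  by rewrite /= !shift_head_at addrA.
- exists (g^-1)%g; first exact: subgroupV.
  apply/funext => c; rewrite -[LHS]/(bij_inv g c).
  have := @shift_ruleK d n k (- v) c; rewrite opprK -gE => {1}<-.
  exact: bij_funK.
- have [g _ gE] := shift_SHIFT n k (delta_mx 0 i : Zd).
  by exists g => //; apply: HU; exists i.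
Qed.

Lemma window_realized (H : set (bijection (config d n k))) c0 s : uniq s ->
  (window_perms s `<=` H)%classic -> all_perms H s.
Proof.
move=> us HW h; have [g _ gE] := act_LP c0 h us.
by exists g => //; apply: HW; exists h.
Qed.

End Oblivious.

Theorem theorem4 (d n k : nat) (hd : 1 <= d) (hn : 1 <= n) (hk : 1 <= k) :
  finitely_generated (OB d n k).
Proof.
pose c0 : ('rV[int]_d -> 'I_n) * state k :=
  (fun=> Ordinal hn, exist _ (Ordinal (hk : 1 < k.+1)) isT).
(* Any four distinct cells would do; the diagonal has them in every positive dimension. *)
pose s0 := mkseq (fun i : nat => const_mx (Posz i) : 'rV[int]_d) 4.
pose s1 i : seq 'rV[int]_d := [:: 0%R; delta_mx 0%R i].
have us0 : uniq s0 by exact: uniq_diagonal.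
have us1 i : uniq (s1 i).
  rewrite /= inE andbT; apply/eqP => /matrixP /(_ 0%R i).
  by rewrite !mxE !eqxx.
pose S : set (bijection (config d n k)) :=
  (@unit_shifts d n k `|` \bigcup_i @window_perms d n k (s1 i)
     `|` @window_perms d n k s0)%classic.
exists S; split.
  rewrite !finite_setU; split; first split.
  - exact: finite_bijections.
  - apply: bigcup_finite => [|i _]; first exact: finite_finset.
    exact: finite_bijections.
  - exact: finite_bijections.
have sgS := generated_subgroupP S.
have SG : (S `<=` generated_subgroup S)%classic by exact: sub_gen_smallest.
apply/seteqP; split.
  (* Every element of [S] is a shift or a local permutation. *)
  apply: smallest_sub; first exact: generated_subgroupP.
  apply: (subset_trans _ (@sub_gen_smallest _ _ _)) => g.
  have winLP s : uniq s -> window_perms s g ->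
      (@SHIFT d n k `|` @LP d n k)%classic g.
    move=> us [h gE]; right; have [g' g'LP g'E] := act_LP c0 h us.
    by rewrite (bijection_eqP (etrans gE (esym g'E))).
  move=> [[[i gE]|[i _ gW]]|gW]; [|exact: winLP gW|exact: winLP gW].
  left; have [g' g'S g'E] := shift_SHIFT n k (delta_mx 0%R i : 'rV[int]_d).
  by rewrite (bijection_eqP (etrans gE (esym g'E))).
have shifts v :
    exists2 g, generated_subgroup S g &
      bij_fun g = turing_map (shift_rule n k v).
  by apply: (shifts_of_units sgS) => g gU; apply: SG; do 2!left.
apply: smallest_sub => // g [[_ [v gE]]|/LP_local[f [s [us finj sf gE]]]].
  by have [h Hh hE] := shifts v; rewrite (bijection_eqP (etrans gE (esym hE))).
have perms s' : uniq s' -> (@window_perms d n k s' `<=` S)%classic ->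
    all_perms (generated_subgroup S) s'.
  by move=> us' WS; apply: (window_realized c0 us'); exact: subset_trans SG.
have [] : realized (generated_subgroup S) f; last first.
  by move=> h Hh hE; rewrite (bijection_eqP (etrans gE (esym hE))).
(* The window [s] of [f] may have fewer than four cells, so it is enlarged by [s0]. *)
apply: (all_local_large sgS shifts c0 hd us0 _ _ _
  (s := undup (s ++ s0))) => //.
- move=> i; apply: (all_perms_local c0 (us1 i)); apply: perms => // h hW.
  by left; right; exists i.
- by apply: perms => // h hW; right.
- exact: undup_uniq.
- rewrite (@leq_trans (size s0))//; apply: uniq_leq_size => // t ts.
  by rewrite mem_undup mem_cat ts orbT.
- by apply: local_sub sf => t ts; rewrite mem_undup mem_cat ts.
Qed.
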